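(* Let $H$ be a separable infinite-dimensional complex Hilbert space and let $B_{sk}(H)=\{a\in B(H):a^*=-a\}$ be the Lie algebra of skew-adjoint bounded operators on $H$. Then every ultraweakly continuous local inner derivation on $B_{sk}(H)$ is an inner derivation.
   Context: $B(H)$ is the algebra of all bounded linear operators on $H$; the Lie bracket on $B_{sk}(H)$ is $[a,b]=ab-ba$, and $B_{sk}(H)$ is regarded as a real Lie algebra. An inner derivation of $B_{sk}(H)$ is a map $R_a(x)=[a,x]$ with $a\in B_{sk}(H)$. A local inner derivation on $B_{sk}(H)$ is a (real-)linear map $\nabla:B_{sk}(H)\to B_{sk}(H)$ such that for every $x\in B_{sk}(H)$ there is $a\in B_{sk}(H)$ (depending on $x$) with $\nabla(x)=[a,x]$. Ultraweakly continuous means continuous for the ultraweak ($\sigma$-weak) topology of $B(H)$ restricted to $B_{sk}(H)$. *)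

(* Defs.v *)
From HB Require Import structures.
From mathcomp Require Import all_boot all_order all_algebra.
From mathcomp Require Import all_classical all_reals all_analysis.
From mathcomp Require Import complex.
Import Order.TTheory GRing.Theory Num.Theory.
Import numFieldNormedType.Exports.

Set Implicit Arguments.
Unset Strict Implicit.
Unset Printing Implicit Defensive.

Local Open Scope classical_set_scope.
Local Open Scope ring_scope.
Local Open Scope complex_scope.

(* A complex Hilbert space is a complete normed R[i]-module H together with a
   dot product (linear in the first argument, conjugate-linear in the second)
   that induces the norm of H. *)
Definition inner_product_of_norm (R : realType) (H : normedModType R[i])
    (dot : {dot H for Num.conj}) : Prop :=
  forall u : H, dot u u = `|u| ^+ 2.

Definition separable (T : topologicalType) : Prop :=
  exists2 D : set T, countable D & dense D.

Definition infinite_dimensional (K : fieldType) (V : lmodType K) : Prop :=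
  ~ exists n (e : 'I_n -> V),
      forall v : V, exists c : 'I_n -> K, v = \sum_(i < n) c i *: e i.

Section Operators.
Variables (R : realType) (H : normedModType R[i]).

Definition bounded_operator : set (H -> H) :=
  [set T | linear T /\
           exists M : R, forall x : H, `|T x| <= M%:C * `|x|].

Variable dot : {dot H for Num.conj}.

(* S is the adjoint of T; there is at most one such S (adjoint_unique). *)
Definition adjoint (T S : H -> H) : Prop :=
  forall x y : H, dot (T x) y = dot x (S y).

Lemma adjoint_unique (T S S' : H -> H) : adjoint T S -> adjoint T S' -> S = S'.
Proof.
move=> TS TS'; apply/funext => y; apply/eqP; rewrite -subr_eq0.
have dot0 x : dot x (S y - S' y) = 0.
  by rewrite (linearB (dot x)) /= -TS -TS' subrr.
by apply/negPn/negP => /(neq0_dnorm_gt0 (s := dot)); rewrite dot0 ltxx.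
Qed.

(* a ^* = - a *)
Definition skew_adjoint_operator : set (H -> H) :=
  [set a | bounded_operator a /\ adjoint a (- a)].

Definition lie_bracket (a b : H -> H) : H -> H := (a \o b) - (b \o a).

(* Maps of B_sk(H) into itself are represented by total functions nabla on
   H -> H, of which only the values on B_sk(H) are constrained or used. *)
Definition inner_derivation (nabla : (H -> H) -> (H -> H)) : Prop :=
  exists2 a, skew_adjoint_operator a &
    forall x, skew_adjoint_operator x -> nabla x = lie_bracket a x.

Definition local_inner_derivation (nabla : (H -> H) -> (H -> H)) : Prop :=
  [/\ set_fun skew_adjoint_operator skew_adjoint_operator nabla,
      (forall (r : R) x y, skew_adjoint_operator x -> skew_adjoint_operator y ->
         nabla (r%:C *: x + y) = r%:C *: nabla x + nabla y) &
      (forall x, skew_adjoint_operator x ->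
         exists2 a, skew_adjoint_operator a & nabla x = lie_bracket a x)].

Definition square_summable : set (nat -> H) :=
  [set xi | cvgn (series (fun n => `|xi n| ^+ 2) : nat -> R[i]^o)].

Definition ultraweak_functional
    (i : square_summable * square_summable) (T : H -> H) : R[i]^o :=
  limn (series (fun n => dot (T (\val i.1 n)) (\val i.2 n)) : nat -> R[i]^o).

(* The ultraweak topology is the initial topology for the family of the
   functionals T |-> \sum_n dot (T (xi n)) (eta n), with xi and eta square
   summable. It is put on all functions H -> H, where these series may diverge
   and the limit be meaningless, but it is only used on B_sk(H): the topology
   induced there depends only on the values of the functionals on B_sk(H). *)
Definition ultraweak : Type :=
  sup_topology (fun i => Topological.class
                  (initial_topology (ultraweak_functional i))).

HB.instance Definition _ := Topological.copy ultraweak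
  (sup_topology (fun i => Topological.class
                  (initial_topology (ultraweak_functional i)))).

Definition ultraweakly_continuous (nabla : (H -> H) -> (H -> H)) : Prop :=
  {within (skew_adjoint_operator : set ultraweak),
    continuous (nabla : ultraweak -> ultraweak)}.

End Operators.

(* Main.v *)
Require Import Defs.
From mathcomp Require Import all_boot all_order all_algebra.
From mathcomp Require Import all_classical all_reals all_analysis.
From mathcomp Require Import complex.
From mathcomp Require Import ring.
Import Order.TTheory GRing.Theory Num.Theory.
Import numFieldNormedType.Exports.

Set Implicit Arguments.
Unset Strict Implicit.
Unset Printing Implicit Defensive.

Local Open Scope ring_scope.

(* Write theta u v for the rank one operator z |-> <z, v> u and let D be the
   complex-linear extension of nabla. On a finite rank selfadjoint x, locality
   gives tr (D(x) x) = 0 and tr (D(x) x^2) = 0. Polarizing the first identity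
   shows that D is antisymmetric for the trace form; polarizing the second one
   and using this antisymmetry shows that D is a Jordan derivation on finite rank
   operators. With e a unit vector, a u := D(theta u e) e is skew-symmetric, and
   D - [a, .] is a Jordan derivation which must vanish on rank one operators. By
   the Hellinger-Toeplitz theorem a is bounded. Finally, for an arbitrary x and
   vector u there is a finite rank skew-adjoint f with (x + f) u = 0; locality at
   x + f forces <nabla (x + f) u, u> = 0, so that
   <nabla x u, u> = - <[a, f] u, u> = <[a, x] u, u>. *)

(** * Polarization of sesquilinear forms over a closed field *)

Section Polarization.
Variables (C : numClosedFieldType) (V : lmodType C).

Definition sesquilinear (F : V -> V -> C) : Prop :=
  (forall c u u' v, F (c *: u + u') v = c * F u v + F u' v) /\
  (forall c u v v', F u (c *: v + v') = c^* * F u v + F u v').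

Variable F : V -> V -> C.
Hypothesis hF : sesquilinear F.

Lemma sesqDl u u' v : F (u + u') v = F u v + F u' v.
Proof. by rewrite -[u]scale1r hF.1 scale1r mul1r. Qed.

Lemma sesqDr u v v' : F u (v + v') = F u v + F u v'.
Proof. by rewrite -[v]scale1r hF.2 scale1r rmorph1 mul1r. Qed.

Lemma sesq0l v : F 0 v = 0.
Proof. by apply: (addrI (F 0 v)); rewrite -sesqDl !addr0. Qed.

Lemma sesq0r u : F u 0 = 0.
Proof. by apply: (addrI (F u 0)); rewrite -sesqDr !addr0. Qed.

Lemma sesqZl c u v : F (c *: u) v = c * F u v.
Proof. by rewrite -[c *: u]addr0 hF.1 sesq0l addr0. Qed.

Lemma sesqZr c u v : F u (c *: v) = c^* * F u v.
Proof. by rewrite -[c *: v]addr0 hF.2 sesq0r addr0. Qed.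

Lemma sesqBl u u' v : F (u - u') v = F u v - F u' v.
Proof. by rewrite -scaleN1r sesqDl sesqZl mulN1r. Qed.

Lemma sesqBr u v v' : F u (v - v') = F u v - F u v'.
Proof. by rewrite -scaleN1r sesqDr sesqZr rmorphN1 mulN1r. Qed.

(** The value at [u + v] gives [F u v + F v u = 0]; the value at [u + 'i *: v] gives
    [F v u = F u v]. *)
Lemma polarization : (forall u, F u u = 0) -> forall u v, F u v = 0.
Proof.
move=> F0 u v.
have := F0 (u + v); rewrite sesqDl !sesqDr !F0 add0r addr0 => h1.
have := F0 (u + 'i *: v).
rewrite sesqDl !sesqDr sesqZl !sesqZr sesqZl !F0 conjCi !mulr0 add0r addr0.
have -> : - 'i * F u v + 'i * F v u = 'i * ((F u v + F v u) - 2 * F u v).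
  by ring.
rewrite h1 => /eqP; rewrite mulf_eq0 (negPf (neq0Ci _)) sub0r oppr_eq0.
by rewrite mulf_eq0 pnatr_eq0 => /eqP.
Qed.

End Polarization.

(** * Matrix coefficients of Jordan derivations on rank one operators *)

Section JordanForms.
Variables (C : numClosedFieldType) (V : lmodType C).
Variable dot : {dot V for Num.conj}.
Local Notation "''[' u , v ]" := (dot u v).

Lemma dotC u v : '[u, v] = '[v, u]^*.
Proof. by rewrite hermC mul1r. Qed.

Lemma dot_sesquilinear : sesquilinear dot.
Proof.
by split=> [c u u' v|c u v v']; rewrite ?linearPl ?linearPr.
Qed.

Definition dotDl := sesqDl dot_sesquilinear.
Definition dot0l := sesq0l dot_sesquilinear.
Definition dot0r := sesq0r dot_sesquilinear.
Definition dotBl := sesqBl dot_sesquilinear.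
Definition dotBr := sesqBr dot_sesquilinear.
Definition dotDr := sesqDr dot_sesquilinear.
Definition dotZl := sesqZl dot_sesquilinear.
Definition dotZr := sesqZr dot_sesquilinear.

(* If [B u v z w = <D(theta u v) z, w>] for an operator-valued [D], this says
   that [D (x y + y x) = D(x) y + x D(y) + D(y) x + y D(x)] for the rank one
   operators [x = theta b b'] and [y = theta c c']. *)
Definition jordan_form (B : V -> V -> V -> V -> C) : Prop :=
  forall a a' b b' c c',
    '[c, b'] * B b c' a a' + '[b, c'] * B c b' a a' =
      B b b' a c' * '[c, a'] + '[a, c'] * B b b' c a' +
      B c c' a b' * '[b, a'] + '[a, b'] * B c c' b a'.

(** In operator terms, [D] commutes with the adjoint, since theta v u is the adjoint of theta u
    v. *)
Definition hermitian_form (B : V -> V -> V -> V -> C) : Prop :=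
  forall u v z w, B u v z w = (B v u w z)^*.

Lemma jordan_form_eq0 (E : V -> V -> V -> V -> C) (e : V) :
    (forall z w, sesquilinear (fun u v => E u v z w)) ->
    jordan_form E -> hermitian_form E -> '[e, e] = 1 ->
    (forall u w, E u e e w = 0) ->
  forall u v z w, E u v z w = 0.
Proof.
move=> sE jE hE e1 Ee.
have Ee' v z : E e v z e = 0 by rewrite hE Ee rmorph0.
have Eee z w : E e e z w = 0.
  have := jE z w e e e e; rewrite !e1 !Ee !Ee' !mul1r !mul0r !mulr0 !addr0.
  by rewrite -[X in X + X]mul1r -mulrDl => /eqP; rewrite mulf_eq0 (pnatr_eq0 C 2) => /eqP.
have Eu u z w : E u e z w = E u e z e * '[e, w].
  have := jE z w u e e e; rewrite e1 mul1r !Eee !Ee.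
  by rewrite !(mulr0, mul0r, addr0).
have Eu0 u z w : E u e z w = 0.
  rewrite Eu; pose p := u - '[u, e] *: e.
  have up : u = '[u, e] *: e + p by rewrite addrC subrK.
  have ep : '[e, p] = 0.
    by rewrite /p -scaleNr dotDr dotZr e1 mulr1 rmorphN (dotC e u) subrr.
  have [p0|pn0] := eqVneq p 0.
    by rewrite up p0 addr0 (sesqZl (sE _ _)) Eee mulr0 mul0r.
  (* With x = y = theta u e the Jordan identity reduces to [E u e z e * '[u, p] = 0], and ['[u, p] =
     '[p, p]] is nonzero. *)
  have := jE z p u e u e.
  rewrite !(Eu u _ p) !ep !(mulr0, mul0r, addr0, add0r) -mulr2n.
  move/eqP; rewrite eq_sym mulrn_eq0 /= mulf_eq0 => /orP[/eqP->|]; first by rewrite mul0r.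
  by rewrite {1}up dotDl dotZl ep mulr0 add0r dnorm_eq0 (negPf pn0).
move=> u v z w.
(* Here theta u v is the product of theta u e and theta e v, where [E] already vanishes. *)
have := jE z w u e e v; rewrite e1 mul1r Eee !Eu0 (hE e v) Eu0 (hE e v) Eu0.
by rewrite rmorph0 !mulr0 !mul0r !addr0.
Qed.

End JordanForms.

(** * From trace identities to a commutator *)

Section LocalForms.
Variables (C : numClosedFieldType) (V : lmodType C).
Variable dot : {dot V for Num.conj}.
Local Notation "''[' u , v ]" := (dot u v).
Variable B : V -> V -> V -> V -> C.
Hypothesis sB : forall z w, sesquilinear (fun u v => B u v z w).
Hypothesis sB' : forall u v, sesquilinear (B u v).
Hypothesis hB : hermitian_form B.
(* [D(x) = [b, x]] for [x] the sum of the three [theta uj uj]. *)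
Hypothesis localB : forall u1 u2 u3, exists b : V -> V, forall z w,
  B u1 u1 z w + B u2 u2 z w + B u3 u3 z w =
    ('[z, u1] * '[b u1, w] + '[z, u2] * '[b u2, w] + '[z, u3] * '[b u3, w]) -
    ('[b z, u1] * '[u1, w] + '[b z, u2] * '[u2, w] + '[b z, u3] * '[u3, w]).

Let B0 z w : B 0 0 z w = 0.
Proof. exact: (sesq0l (sB z w)). Qed.

Lemma trace_square u1 u2 u3 :
  let D z w := B u1 u1 z w + B u2 u2 z w + B u3 u3 z w in
  D u1 u1 + D u2 u2 + D u3 u3 = 0.
Proof. by have [b h] := localB u1 u2 u3; rewrite /= !h; ring. Qed.

(** This is tr (D(x) x^2) for x the sum of the theta uj uj. *)
Let cube u1 u2 u3 :=
  let D z w := (B u1 u1 z w + B u2 u2 z w + B u3 u3 z w) * '[w, z] in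
  D u1 u1 + D u1 u2 + D u1 u3 + (D u2 u1 + D u2 u2 + D u2 u3) +
  (D u3 u1 + D u3 u2 + D u3 u3).

Lemma trace_cube u1 u2 u3 : cube u1 u2 u3 = 0.
Proof. by have [b h] := localB u1 u2 u3; rewrite /cube !h; ring. Qed.

(** [B u v z w] is the trace of D(theta u v) theta z w. The diagonal case is the cross term of
    [trace_square] at two vectors; each pair is then polarized. *)
Lemma local_antisym u v z w : B u v z w = - B z w u v.
Proof.
apply/eqP; rewrite -addr_eq0; apply/eqP.
have D2 p q : B p p q q + B q q p p = 0.
  have := trace_square p q 0; have := trace_square p 0 0.
  have := trace_square q 0 0.
  rewrite /= !B0 !(sesq0l (sB' _ _)) !addr0 => -> ->.
  by rewrite add0r addr0 addrC.
have D3 p q q' : B p p q q' + B q q' p p = 0.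
  apply: (@polarization _ _ (fun q q' => B p p q q' + B q q' p p)) => //.
  by split=> *; rewrite ((sB' _ _).1, (sB' _ _).2) ((sB _ _).1, (sB _ _).2); ring.
apply: (@polarization _ _ (fun u v => B u v z w + B z w u v)) => //.
by split=> *; rewrite ((sB _ _).1, (sB _ _).2) ((sB' _ _).1, (sB' _ _).2); ring.
Qed.

(* The full polarization of [tr (D(x) x^2)]: the cyclic sum of
   [tr (D(x) (y z + z y))] for [x = theta a a'], [y = theta b b'], [z = theta c c']. *)
Let trilinear a a' b b' c c' :=
  B a a' b c' * '[c, b'] + B a a' c b' * '[b, c'] +
  (B b b' a c' * '[c, a'] + B b b' c a' * '[a, c']) +
  (B c c' a b' * '[b, a'] + B c c' b a' * '[a, b']).

Lemma trilinear_eq0 a a' b b' c c' : trilinear a a' b b' c c' = 0.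
Proof.
have T3 p q r : trilinear p p q q r r = 0.
  (* Inclusion-exclusion over the three vectors keeps only the terms of [cube] that involve all of
     them. *)
  have -> : trilinear p p q q r r =
      cube p q r - (cube p q 0 + cube p 0 r + cube 0 q r) +
      (cube p 0 0 + cube 0 q 0 + cube 0 0 r).
    by rewrite /cube /trilinear !B0 !dot0l !dot0r; ring.
  by rewrite !trace_cube !addr0 subrr.
have ld := dot_sesquilinear dot.
have T2 p q r r' : trilinear p p q q r r' = 0.
  apply: (@polarization _ _ (trilinear p p q q)) => //; split=> *; rewrite /trilinear.
    by rewrite !(sB _ _).1 !(sB' _ _).1 !ld.1; ring.
  by rewrite !(sB _ _).2 !(sB' _ _).2 !ld.2; ring.
have T1 p q q' r r' : trilinear p p q q' r r' = 0.
  apply: (@polarization _ _ (fun q q' => trilinear p p q q' r r')) => //.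
  split=> *; rewrite /trilinear.
    by rewrite !(sB _ _).1 !(sB' _ _).1 !ld.1; ring.
  by rewrite !(sB _ _).2 !(sB' _ _).2 !ld.2; ring.
apply: (@polarization _ _ (fun a a' => trilinear a a' b b' c c')) => //.
split=> *; rewrite /trilinear.
  by rewrite !(sB _ _).1 !(sB' _ _).1 !ld.1; ring.
by rewrite !(sB _ _).2 !(sB' _ _).2 !ld.2; ring.
Qed.

(** Antisymmetry turns tr (D(x) (y z + z y)) into - tr (x D(y z + z y)); as x = theta a a' is
    arbitrary, this tests the Jordan identity for y and z. *)
Lemma local_jordan : jordan_form dot B.
Proof.
move=> a a' b b' c c'; have := trilinear_eq0 a a' b b' c c'.
rewrite /trilinear (local_antisym a a' b) (local_antisym a a' c) => h.
by apply/eqP; rewrite -subr_eq0 -oppr_eq0; apply/eqP; rewrite -[RHS]h; ring.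
Qed.

(** Subtracting the form of [A, .] from [B] leaves a hermitian Jordan form; ['[A e, e] = 0] gives
    the normalization at [e] required by [jordan_form_eq0]. *)
Lemma local_form_inner (e : V) (A : V -> V) :
    '[e, e] = 1 -> (forall u w, '[A u, w] = B u e e w) ->
  (forall u v, '[A u, v] = - '[u, A v]) /\
  (forall u v z w, B u v z w = '[z, v] * '[A u, w] - '[A z, v] * '[u, w]).
Proof.
move=> e1 hA.
have skA u v : '[A u, v] = - '[u, A v].
  by rewrite hA local_antisym hB -hA -dotC.
have Ae : '[A e, e] = 0.
  have := local_antisym e e e e; rewrite -hA => /eqP.
  by rewrite -addr_eq0 -mulr2n mulrn_eq0 => /eqP.
split=> // u v z w.
pose E u v z w := B u v z w - ('[z, v] * '[A u, w] - '[A z, v] * '[u, w]).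
apply/eqP; rewrite -subr_eq0 -/(E u v z w); apply/eqP.
have ld := dot_sesquilinear dot.
have sA w' : forall c p q, '[A (c *: p + q), w'] = c * '[A p, w'] + '[A q, w'].
  by move=> c p q; rewrite !hA (sB _ _).1.
apply: (@jordan_form_eq0 _ _ dot E e) => //.
- by move=> z' w'; split=> *; rewrite /E ?((sB _ _).1, ld.1, sA) ?((sB _ _).2, ld.2); ring.
- move=> a a' b b' c c'; rewrite /E.
  apply/eqP; rewrite -subr_eq0; apply/eqP.
  by rewrite -[RHS](subrr (B b b' a c' * '[c, a'] + '[a, c'] * B b b' c a' +
      B c c' a b' * '[b, a'] + '[a, b'] * B c c' b a')) -{1}local_jordan; ring.
- move=> p q r s; rewrite /E hB !rmorphB !rmorphM /=.
  rewrite (skA q) (skA s) !rmorphN /=.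
  by rewrite -!dotC; ring.
- by move=> p q; rewrite /E e1 Ae -hA; ring.
Qed.

End LocalForms.

Local Open Scope complex_scope.

(** * Automatic boundedness of skew-symmetric operators *)

Section HellingerToeplitz.
Local Open Scope classical_set_scope.
Variables (R : realType) (H : completeNormedModType R[i]).
Variable dot : {dot H for Num.conj}.
Hypothesis hdot : inner_product_of_norm dot.
Local Notation "''[' u , v ]" := (dot u v).

Lemma cauchy_schwarz u v : `|'[u, v]| <= `|u| * `|v|.
Proof.
have [->|v0] := eqVneq v 0; first by rewrite linear0r !normr0 mulr0.
rewrite -(@ler_pXn2r _ 2) ?nnegrE ?mulr_ge0 // exprMn -!hdot.
have vv : 0 < '[v, v] by rewrite dnorm_gt0.
have := dnorm_ge0 dot ('[v, v] *: u - '[u, v] *: v).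
rewrite dotBl !dotBr !dotZl !dotZr (dotC dot v u) -(dotC dot v v).
set n := '[v, v]; set d := '[u, v].
rewrite (_ : _ + _ = n * ('[u, u] * n - d * d^*%R)); last by ring.
by rewrite pmulr_rge0 // subr_ge0 normCK.
Qed.

Lemma complex_archi (z : R[i]) : 0 <= z -> exists n, z <= n%:R.
Proof.
move=> z0; exists (Num.truncn (complex.Re z)).+1.
rewrite -(RRe_real (ger0_real z0)) -(rmorph_nat (real_complex R)) lecR.
exact/ltW/truncnS_gt.
Qed.

Lemma geometric_cauchy (y : nat -> H) :
  (forall n, `|y n.+1 - y n| <= 3 ^- n) ->
  exists l, forall n, `|l - y n| <= 3 / 2 * 3 ^- n.
Proof.
move=> hy.
have hyk n k : `|y (n + k)%N - y n| <= 3 / 2 * 3 ^- n.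
  (* The bound is the exact partial geometric sum, which makes the induction close. *)
  have : `|y (n + k)%N - y n| <= 3 / 2 * 3 ^- n - 3 / 2 * 3 ^- (n + k).
    elim: k => [|k ih]; first by rewrite addn0 !subrr normr0.
    rewrite addnS -[y (n + k).+1](subrK (y (n + k)%N)) -addrA.
    apply: (le_trans (ler_normD _ _)).
    apply: (le_trans (lerD (hy _) ih)).
    rewrite (exprS _ (n + k)) invfM le_eqVlt; apply/orP; left; apply/eqP.
    by field; rewrite ?expf_neq0 ?pnatr_eq0.
  by move=> /le_trans; apply; rewrite gerBl mulr_ge0 ?divr_ge0 ?invr_ge0 ?exprn_ge0.
have small (e : R[i]) : 0 < e -> exists n, 3 / 2 * 3 ^- n < e.
  move=> e0; have [|n hn] := @complex_archi (3 / 2 / e).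
    by rewrite !divr_ge0 // ltW.
  exists n; rewrite ltr_pdivrMr ?exprn_gt0 // -ltr_pdivrMl // mulrC.
  by apply: (le_lt_trans hn); rewrite -natrX ltr_nat ltn_expl.
have : cvg (y @ \oo).
  apply: cauchy_cvg; apply: cauchy_exP => e /small[n hn]; exists (y n), n => // m /= nm.
  by rewrite -ball_normE /= distrC; apply: le_lt_trans hn; rewrite -(subnKC nm).
move=> /cvg_ex[l yl]; exists l => n; rewrite real_leNgt ?normr_real //.
apply/negP => hn; rewrite -subr_gt0 in hn.
have /cvgrPdist_lt/(_ _ hn)[m _ hm] := yl.
have := hm _ (leq_addl n m) => /=; rewrite ltrBrDr => hlt.
have := le_lt_trans (lerD (lexx _) (hyk n m)) hlt.
move=> /(le_lt_trans (ler_distD (y (n + m)%N) l (y n))).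
by rewrite ltxx.
Qed.

(* A gliding hump: if [a] were unbounded, [y n] would converge to a vector [l]
   at which the functionals [v |-> <a (x n), v>] take values that are too large
   compared with [|x n| |a l|]. *)
Lemma hellinger_toeplitz (a : H -> H) :
  linear a -> (forall u v, '[a u, v] = - '[u, a v]) -> bounded_operator a.
Proof.
move=> la ska; split=> //; apply: contrapT => nb.
(* The factor 3^n offsets the hump size 3^-n, and n remains to beat the constant [2 * |a l|]. *)
have hx n : exists x, n%:R * 3 ^+ n * `|x| < `|a x|.
  apply: contrapT => /forallNP hn; apply: nb; exists (n%:R * 3 ^+ n) => x.
  have := hn x; rewrite real_ltNge ?realM ?normr_real ?ger0_real ?exprn_ge0 //.
  by move=> /negP; rewrite negbK rmorphM rmorphXn /= !rmorph_nat.
have [x {}hx] := choice hx.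
have ax n : 0 < `|a (x n)|.
  by apply: le_lt_trans (hx n); rewrite !mulr_ge0 ?exprn_ge0.
have p3 n : 0 <= 3 ^- n :> R[i] by rewrite invr_ge0 exprn_ge0.
pose u n := (3 ^- n / `|a (x n)|) *: a (x n).
pose phi n y := `|'[a (x n), y]|.
(* The sign of each hump avoids cancellation: one of |s + t|, |s - t| is at least |t|. *)
pose y := fix y n := if n is m.+1 then
  if phi m (u m) <= phi m (y m + u m) then y m + u m else y m - u m else 0.
have nu n : `|u n| = 3 ^- n.
  by rewrite normrZ ger0_norm ?divr_ge0 // divfK ?gt_eqF.
have hu n : phi n (u n) = 3 ^- n * `|a (x n)|.
  rewrite /phi dotZr hdot normrM norm_conjC normrX normr_id.
  by rewrite ger0_norm ?divr_ge0 // expr2 mulrA divfK ?gt_eqF.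
have yS n : `|y n.+1 - y n| <= 3 ^- n.
  by rewrite -nu /=; case: ifP => _; rewrite addrAC subrr add0r ?normrN.
have phiS n : phi n (u n) <= phi n (y n.+1).
  rewrite /=; case: ifPn => //.
  rewrite -real_ltNge ?normr_real // => /ltW h.
  rewrite -(lerD2l (phi n (u n))); apply: le_trans (lerD h (lexx _)).
  apply: le_trans (ler_normB _ _); rewrite dotDr dotBr.
  rewrite (_ : _ - _ = '[a (x n), u n] *+ 2) ?normrMn ?mulr2n //.
  by ring.
have [l hl] := geometric_cauchy yS.
(* Later humps move the limit by at most 3/2 * 3^-(n+1), half of 3^-n, so at least half of
   [phi n (u n)] survives. *)
have philow n : 3 ^- n * `|a (x n)| <= 2 * phi n l.
  have h1 : phi n (y n.+1) <= phi n l + `|a (x n)| * (3 / 2 * 3 ^- n.+1).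
    apply: le_trans (lerD (lexx _) (ler_wpM2l (normr_ge0 _) (hl n.+1))).
    apply: le_trans (lerD (lexx _) (cauchy_schwarz _ _)).
    apply: le_trans (ler_normB _ _).
    by rewrite dotBr opprB addrCA subrr addr0.
  have := le_trans (phiS n) h1; rewrite hu -lerBlDr -(ler_pM2l (_ : 0 < 2)) //.
  congr (_ <= _); rewrite exprS; field.
  by rewrite ?expf_neq0 ?pnatr_eq0.
have phiup n : phi n l <= `|x n| * `|a l|.
  by rewrite /phi ska normrN cauchy_schwarz.
have [|n hn] := @complex_archi (2 * `|a l|); first by rewrite mulr_ge0.
have := le_trans (philow n) (ler_wpM2l (ler0n _ 2) (phiup n)).
have := hx n; rewrite -mulrA mulrCA -ltr_pdivlMl ?exprn_gt0 // => h1 h2.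
have := lt_le_trans h1 h2; rewrite mulrCA [_ * `|x n|]mulrC.
move=> /(le_lt_trans (ler_wpM2l (normr_ge0 _) hn)).
by rewrite ltxx.
Qed.

End HellingerToeplitz.

(** * Skew-adjoint operators and finite rank examples *)

Section SkewOperators.
Variables (R : realType) (H : completeNormedModType R[i]).
Variable dot : {dot H for Num.conj}.
Hypothesis hdot : inner_product_of_norm dot.
Local Notation "''[' u , v ]" := (dot u v).

Lemma skew_adjointE (x : H -> H) u v :
  skew_adjoint_operator dot x -> '[x u, v] = - '[u, x v].
Proof.
move=> [_ /(_ u v) ->]; rewrite -[LHS]/('[u, - x v]).
by rewrite -[- x v]add0r dotBr dot0r sub0r.
Qed.

Lemma skew_adjoint_lin (r : R) (x y : H -> H) :
  skew_adjoint_operator dot x -> skew_adjoint_operator dot y ->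
  skew_adjoint_operator dot (r%:C *: x + y).
Proof.
move=> sx sy; have [[lx [M hM]] _] := sx; have [[ly [N hN]] _] := sy.
have val u : (r%:C *: x + y) u = r%:C *: x u + y u by [].
split; [split|].
- by move=> c u v; rewrite !val lx ly !scalerDr !scalerA (mulrC c) addrACA.
- exists (`|r| * M + N) => u; rewrite val (le_trans (ler_normD _ _)) //.
  rewrite rmorphD rmorphM mulrDl lerD //= normrZ -mulrA.
  by rewrite normc_def /= expr0n addr0 sqrtr_sqr ler_wpM2l ?ler0c.
- move=> u v; rewrite val -[RHS]/('[u, - (r%:C *: x v + y v)]).
  rewrite -[- _]add0r dotBr dot0r dotDl dotZl dotDr dotZr.
  rewrite (skew_adjointE u v sx) (skew_adjointE u v sy).
  have -> : r%:C^*%R = r%:C by rewrite conj_Creal //; apply/complex_realP; exists r.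
  by ring.
Qed.

(** This is theta u v minus its adjoint theta v u. *)
Definition skew_rank_two (u v : H) : H -> H :=
  fun z => '[z, v] *: u - '[z, u] *: v.

Lemma skew_rank_two_skew_adjoint u v :
  skew_adjoint_operator dot (skew_rank_two u v).
Proof.
split; [split|].
- move=> c z w; rewrite /skew_rank_two !dotDl !dotZl scalerBr !scalerDl !scalerA.
  by rewrite opprD addrACA.
- exists (2 * complex.Re (`|u| * `|v|)) => z.
  rewrite rmorphM rmorph_nat /= RRe_real ?realM ?normr_real //.
  apply: (le_trans (ler_normB _ _)); rewrite !normrZ.
  have h1 := ler_wpM2r (normr_ge0 u) (cauchy_schwarz hdot z v).
  have h2 := ler_wpM2r (normr_ge0 v) (cauchy_schwarz hdot z u).
  apply: le_trans (lerD h1 h2) _.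
  by rewrite le_eqVlt; apply/orP; left; apply/eqP; ring.
- move=> z w; rewrite -[RHS]/('[z, - skew_rank_two u v w]) /skew_rank_two.
  rewrite opprB dotBl dotBr !dotZl !dotZr -!dotC; ring.
Qed.

Lemma inner_diagonal_eq (x y : H -> H) :
  linear x -> linear y -> (forall u, '[x u, u] = '[y u, u]) -> x = y.
Proof.
move=> lx ly xy; apply/funext => z; apply/eqP; rewrite -subr_eq0 -(dnorm_eq0 dot).
apply/eqP; rewrite dotBl.
apply: (@polarization _ _ (fun u v => '[x u, v] - '[y u, v])).
  by split=> *; rewrite ?lx ?ly !(dotDl, dotZl, dotDr, dotZr); ring.
by move=> u; rewrite xy subrr.
Qed.

End SkewOperators.

(** * Complexification of [nabla] and its implementation *)

Section LocalInner.
Variables (R : realType) (H : completeNormedModType R[i]).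
Variable dot : {dot H for Num.conj}.
Hypothesis hdot : inner_product_of_norm dot.
Variable nabla : (H -> H) -> (H -> H).
Hypothesis hlocal : local_inner_derivation dot nabla.
Local Notation "''[' u , v ]" := (dot u v).
Local Notation skew := (skew_adjoint_operator dot).
Local Notation K := (skew_rank_two dot).

Let skK u v : skew (K u v). Proof. exact: skew_rank_two_skew_adjoint. Qed.

Let nablaP (r : R) x y : skew x -> skew y ->
  nabla (r%:C *: x + y) = r%:C *: nabla x + nabla y.
Proof. by case: hlocal => _ + _; exact. Qed.

Let skD x y : skew x -> skew y -> skew (x + y).
Proof. by move=> sx sy; have := skew_adjoint_lin 1 sx sy; rewrite scale1r. Qed.

Let nablaD x y : skew x -> skew y -> nabla (x + y) = nabla x + nabla y.
Proof. by move=> sx sy; have := nablaP 1 sx sy; rewrite !scale1r. Qed.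

Let sk_nabla x : skew x -> skew (nabla x).
Proof. by case: hlocal => + _ _; exact. Qed.

(* The matrix coefficients of the complex-linear extension of [nabla], taken at
   the rank one operator [theta u v]. *)
Definition complex_form (u v z w : H) : R[i] :=
  ('[nabla (K u v) z, w] - 'i * '[nabla (K ('i *: u) v) z, w]) / 2.

Local Notation N u v z w := '[nabla (K u v) z, w].

Let NP (r : R) u u' v z w :
  N (r%:C *: u + u') v z w = r%:C * N u v z w + N u' v z w.
Proof.
have -> : K (r%:C *: u + u') v = r%:C *: K u v + K u' v.
  apply/funext => t; rewrite /skew_rank_two.
  rewrite -[RHS]/(r%:C *: ('[t, v] *: u - '[t, u] *: v) + ('[t, v] *: u' - '[t, u'] *: v)).
  rewrite dotDr dotZr conj_Creal; last by apply/complex_realP; exists r.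
  by rewrite scalerDr scalerBr scalerDl !scalerA !(mulrC r%:C) opprD addrACA.
by rewrite nablaP // -dotZl -dotDl.
Qed.

Let nabla0 : nabla 0 = 0.
Proof.
have sk0 : skew 0.
  rewrite (_ : 0 = K 0 0) //; apply/funext => t.
  by rewrite /skew_rank_two subrr.
by apply: (addrI (nabla 0)); rewrite -nablaD // !addr0.
Qed.

Let NC u v z w : N v u z w = - N u v z w.
Proof.
apply/eqP; rewrite -addr_eq0 -dotDl -[_ + _]/((nabla (K v u) + nabla (K u v)) z).
rewrite -nablaD // (_ : K v u + K u v = 0) ?nabla0 ?dot0l //.
apply/funext => t; rewrite -[LHS]/(K v u t + K u v t) /skew_rank_two.
by rewrite addrC -opprB addNr.
Qed.

Let NZr c u v z w : N u (c *: v) z w = N (c^*%R *: u) v z w.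
Proof.
rewrite (_ : K u (c *: v) = K (c^*%R *: u) v) //; apply/funext => t.
by rewrite /skew_rank_two !dotZr conjCK !scalerA (mulrC _^*%R) (mulrC c).
Qed.

Let Nherm u v z w : N u v z w = - (N u v w z)^*%R.
Proof. by rewrite (skew_adjointE _ _ (sk_nabla (skK u v))) (dotC dot z). Qed.

Let ii : 'i * 'i = -1 :> R[i].
Proof. by rewrite -expr2 sqrCi. Qed.

Let NPC c u u' v z w : N (c *: u + u') v z w =
  (complex.Re c)%:C * N u v z w + (complex.Im c)%:C * N ('i *: u) v z w + N u' v z w.
Proof. by rewrite {1}[c]complexE scalerDl -addrA NP (mulrC 'i) -scalerA NP addrA. Qed.

Let NN u v z w : N (- u) v z w = - N u v z w.
Proof.
have N0 : N 0 v z w = 0.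
  apply: (addrI (N 0 v z w)).
  by have := NP 1 0 0 v z w; rewrite scaler0 addr0 mul1r => <-; rewrite addr0.
have := NP (-1) u 0 v z w.
by rewrite rmorphN1 scaleN1r mulN1r N0 !addr0.
Qed.

Let Ni u v z w : N ('i *: v) u z w = N ('i *: u) v z w.
Proof. by rewrite NC NZr conjCi scaleNr NN opprK. Qed.

(** The formula encodes theta u v = (K u v - i K (i u) v) / 2. Real linearity comes from [nabla],
    and replacing [u] by ['i *: u] multiplies the expression by i. *)
Lemma complex_form_linl c u u' v z w :
  complex_form (c *: u + u') v z w = c * complex_form u v z w + complex_form u' v z w.
Proof.
rewrite /complex_form scalerDr scalerA (mulrC _ c) -scalerA !NPC scalerA ii.
rewrite scaleN1r NN [in RHS](complexE c) -['i%C]/'i%R.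
by ring: ii.
Qed.

Lemma complex_form_herm : hermitian_form complex_form.
Proof.
move=> u v z w; rewrite /complex_form (NC u v w z) (Ni u v w z).
rewrite (Nherm u v z) (Nherm ('i *: u) v z) rmorphM rmorphB rmorphM fmorphV rmorph_nat rmorphN.
by rewrite /= conjCi; ring.
Qed.

Lemma complex_form_sesq z w : sesquilinear (fun u v => complex_form u v z w).
Proof.
split=> [c u u' v|c u v v']; first exact: complex_form_linl.
rewrite complex_form_herm complex_form_linl rmorphD rmorphM /=.
by rewrite -!complex_form_herm.
Qed.

Lemma complex_form_sesq' u v : sesquilinear (complex_form u v).
Proof.
have lN p q : linear (nabla (K p q)) by case: (sk_nabla (skK p q)) => -[].
by split=> *; rewrite /complex_form ?lN !(dotDl, dotZl, dotDr, dotZr); field.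
Qed.

Lemma complex_form_sub u v z w :
  complex_form u v z w - complex_form v u z w = N u v z w.
Proof. by rewrite /complex_form (NC u v z w) (Ni u v z w); field. Qed.

Lemma complex_form_local u1 u2 u3 : exists b : H -> H, forall z w,
  complex_form u1 u1 z w + complex_form u2 u2 z w + complex_form u3 u3 z w =
    ('[z, u1] * '[b u1, w] + '[z, u2] * '[b u2, w] + '[z, u3] * '[b u3, w]) -
    ('[b z, u1] * '[u1, w] + '[b z, u2] * '[u2, w] + '[b z, u3] * '[u3, w]).
Proof.
(* [T u] is 2 i theta u u, so locality applies to the skew-adjoint sum of the [T uj], and dividing
   by 2 i returns to the selfadjoint x. *)
pose T u := K ('i *: u) u.
have skT u : skew (T u) by exact: skK.
have sT : skew (T u1 + T u2 + T u3) by apply: (skD (skD (skT u1) (skT u2)) (skT u3)).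
have TE t : (T u1 + T u2 + T u3) t =
    (2 * 'i) *: ('[t, u1] *: u1 + '[t, u2] *: u2 + '[t, u3] *: u3).
  have Tt u : T u t = (2 * 'i) *: ('[t, u] *: u).
    rewrite /T /skew_rank_two dotZr conjCi !scalerA -scalerBl; congr (_ *: _).
    by ring.
  by rewrite !scalerDr -!Tt.
have [_ _ /(_ _ sT)[b sb hb]] := hlocal.
have lb : linear b by case: sb => -[].
have Nuu u z w : N u u z w = 0.
  by apply/eqP; have /eqP := NC u u z w; rewrite -addr_eq0 -mulr2n mulrn_eq0.
exists b => z w.
have -> : complex_form u1 u1 z w + complex_form u2 u2 z w + complex_form u3 u3 z w =
    - ('i / 2) * '[nabla (T u1 + T u2 + T u3) z, w].
  rewrite nablaD //; last exact: skD.
  rewrite nablaD //.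
  rewrite -[(_ + _) z]/(nabla (T u1) z + nabla (T u2) z + nabla (T u3) z).
  by rewrite !dotDl /complex_form !Nuu /T; field.
rewrite hb -[lie_bracket _ _ _]/(b (_ z) - (T u1 + T u2 + T u3) (b z)) !TE.
have bZ c t : b (c *: t) = c *: b t := scalable_linear lb c t.
have bD t t' : b (t + t') = b t + b t' by rewrite -[t]scale1r lb !scale1r.
rewrite bZ !bD !bZ dotBl !(dotZl, dotDl).
by rewrite -[RHS]mul1r -[X in _ = X * _]opprK -ii; field.
Qed.

Lemma local_inner_implemented (e : H) : '[e, e] = 1 ->
  exists a : H -> H, [/\ linear a, (forall u v, '[a u, v] = - '[u, a v]) &
    forall u v z w, N u v z w =
      '[z, v] * '[a u, w] - '[a z, v] * '[u, w] -
      ('[z, u] * '[a v, w] - '[a z, u] * '[v, w])].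
Proof.
move=> e1.
(* This is D(theta u e) e written out. *)
pose a u := 2^-1 *: (nabla (K u e) e - 'i *: nabla (K ('i *: u) e) e).
have ha u w : '[a u, w] = complex_form u e e w.
  by rewrite /a dotZl dotBl dotZl mulrC.
clearbody a.
have [ska haN] := local_form_inner complex_form_sesq complex_form_sesq' complex_form_herm
  complex_form_local e1 ha.
exists a; split=> //.
  have key c u v w : '[a (c *: u + v) - (c *: a u + a v), w] = 0.
    by rewrite dotBl dotDl dotZl !ha complex_form_linl subrr.
  by move=> c u v; apply/eqP; rewrite -subr_eq0 -(dnorm_eq0 dot) key.
by move=> u v z w; rewrite -complex_form_sub !haN.
Qed.

(* [x + f] kills [u] for a suitable [f = skew_rank_two v u], and a local
   inner derivation maps an operator killing [u] to one whose diagonal value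
   at [u] vanishes. *)
Lemma local_inner_diagonal (a : H -> H) : linear a ->
    (forall u v z w, N u v z w =
      '[z, v] * '[a u, w] - '[a z, v] * '[u, w] -
      ('[z, u] * '[a v, w] - '[a z, u] * '[v, w])) ->
  forall x u, skew x -> '[nabla x u, u] = '[lie_bracket a x u, u].
Proof.
move=> la hN x u sx.
have lzero (y : H -> H) : linear y -> y 0 = 0.
  by move=> ly; have := ly (-1) 0 0; rewrite scaler0 add0r scaleN1r addNr.
have [[lx _] _] := sx.
have [->|u0] := eqVneq u 0; first by rewrite !dot0r.
have nu : '[u, u] != 0 by rewrite dnorm_eq0.
pose n := '[u, u].
(* Solves [n *: v - '[u, v] *: u = - x u]; the coefficient of [u] relies on ['[u, x u]] being purely
   imaginary. *)
pose v := - (n^-1 *: x u + ('[u, x u] / n ^+ 2 / 2) *: u).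
have hf : K v u u = - x u.
  have nC : n^*%R = n by rewrite /n -dotC.
  have dC : '[u, x u]^*%R = - '[u, x u] by rewrite -dotC (skew_adjointE _ _ sx).
  have uv : '[u, v] = - ('[u, x u] / n / 2).
    rewrite /v -[- _]add0r dotBr dot0r dotDr !dotZr -/n.
    rewrite !rmorphM !fmorphV rmorphXn rmorph_nat /= nC dC; field.
    by rewrite nu.
  rewrite /skew_rank_two uv -/n /v scaleNr opprK scalerN scalerDr !scalerA mulfV // scale1r.
  rewrite (_ : n * _ = '[u, x u] / n / 2); last by field; rewrite nu.
  by rewrite opprD subrK.
pose y := x + K v u.
have sy : skew y by exact: skD.
have yu : y u = 0 by rewrite -[LHS]/(x u + K v u u) hf subrr.
have [_ _ /(_ _ sy)[b sb hb]] := hlocal.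
have hy : '[nabla y u, u] = 0.
  rewrite hb -[lie_bracket _ _ _]/(b (y u) - y (b u)) dotBl yu.
  have [[lb _] _] := sb.
  rewrite (skew_adjointE (b u) u sy) yu lzero //.
  by rewrite dot0l dot0r oppr0 subr0.
move: hy; rewrite /y nablaD // -[(_ + _) u]/(nabla x u + nabla (K v u) u) dotDl hN.
move/eqP; rewrite addr_eq0 => /eqP ->.
(* By skew-adjointness the diagonal value of [a, x] at [u] depends on [x] only through [x u], which
   is [- K v u u]. *)
rewrite -[lie_bracket _ _ _]/(a (x u) - x (a u)) dotBl.
rewrite (skew_adjointE (a u) u sx) -[x u]opprK -hf.
have aZ c t : a (c *: t) = c *: a t := scalable_linear la c t.
have aB t t' : a (t - t') = a t - a t'.
  by rewrite addrC -scaleN1r la scaleN1r addrC.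
rewrite -[- skew_rank_two _ _ _ _]sub0r aB dotBr lzero // !dotBl dotBr.
rewrite /skew_rank_two aB !aZ !(dotBl, dotZl, dotBr, dotZr) -!dotC.
by rewrite !dot0l !dot0r; ring.
Qed.

End LocalInner.

(** * Global implementation by a bounded skew-adjoint operator *)

Theorem theorem5p2 (R : realType) (H : completeNormedModType R[i])
    (dot : {dot H for Num.conj})
    (hdot : inner_product_of_norm dot)
    (hsep : separable H)
    (hinf : infinite_dimensional H)
    (nabla : (H -> H) -> (H -> H))
    (hlocal : local_inner_derivation dot nabla)
    (hcont : ultraweakly_continuous dot nabla) :
  inner_derivation dot nabla.
Proof.
have [e e1] : exists e : H, dot e e = 1.
  (* A zero space would be spanned by the empty family. *)
  have [u u0] : exists u : H, u != 0.
    apply: contrapT => /forallNP h0; apply: hinf; exists 0%N, (fun _ => 0) => v.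
    by exists (fun _ => 0); rewrite big_ord0; have /negP/negPn/eqP := h0 v.
  exists (`|u|^-1 *: u).
  by rewrite hdot normrZ normfV normr_id mulVf ?normr_eq0 // expr1n.
have [a [la ska ha]] := local_inner_implemented hdot hlocal e1.
have ba := hellinger_toeplitz hdot la ska.
have sa : skew_adjoint_operator dot a.
  split=> // u v; rewrite ska -[RHS]/(dot u (- a v)).
  by rewrite -[- a v]add0r dotBr dot0r sub0r.
exists a => // x sx; have [[lx _] _] := sx.
apply: (@inner_diagonal_eq _ _ dot).
- by have [/(_ _ sx) [[]]] := hlocal.
- move=> c u v; rewrite -[LHS]/(a (x _) - x (a _)).
  rewrite -[RHS]/(c *: (a (x u) - x (a u)) + (a (x v) - x (a v))).
  by rewrite lx la la lx scalerBr opprD addrACA.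
- by move=> u; exact: local_inner_diagonal.
Qed.
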